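(* Let $d\ge 1$ and let $S\subset\mathbb{R}^d$ be a finite set of distinct points. Alice wins the game on $S$ if and only if there exists a point $x\in\mathbb{R}^d$ such that every affine hyperplane $H$ through $x$ has at most $|S|/2$ points of $S$ in each of its two open half-spaces. Moreover, if the points of $S$ do not all lie on a single line, then there do not exist two distinct winning points for Alice.
   Context: The game: Alice chooses a point $a\in\mathbb{R}^d$; then Bob, knowing $a$, chooses a point $b\in\mathbb{R}^d$. With $\rho$ the Euclidean distance, the scores are $V_A=|\{x\in S:\rho(a,x)<\rho(b,x)\}|$ and $V_B=|\{x\in S:\rho(b,x)<\rho(a,x)\}|$ (voters equidistant from $a$ and $b$ vote for nobody). A point $a$ is a winning point for Alice if $V_A\ge V_B$ for every choice of $b\in\mathbb{R}^d$; Alice wins if a winning point exists, and otherwise Bob wins. An affine hyperplane is a set $\{x:\langle x,c\rangle=\lambda\}$ with $c\neq 0$; its open half-spaces are $\{x:\langle x,c\rangle>\lambda\}$ and $\{x:\langle x,c\rangle<\lambda\}$. *)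

(* Defs.v *)
From mathcomp Require Import all_boot all_order all_algebra.
From mathcomp Require Import finmap reals.

Set Implicit Arguments.
Unset Strict Implicit.
Unset Printing Implicit Defensive.

Import Order.TTheory GRing.Theory Num.Theory.
Local Open Scope fset_scope.
Local Open Scope ring_scope.

Section VoronoiGame.
Variables (R : realType) (d : nat).
Implicit Types (S : {fset 'rV[R]_d}) (a b c p v x y : 'rV[R]_d) (l : R).

Definition inner x y : R := \sum_(i < d) x ord0 i * y ord0 i.

(* The norm that MathComp-Analysis puts on row vectors is the sup norm, so the
   Euclidean distance is defined here. *)
Definition dist x y : R := Num.sqrt (inner (x - y) (x - y)).

Definition scoreA S a b : nat := #|` [fset x in S | dist a x < dist b x]|.
Definition scoreB S a b : nat := #|` [fset x in S | dist b x < dist a x]|.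

Definition winning S a : Prop := forall b, (scoreB S a b <= scoreA S a b)%N.

Definition alice_wins S : Prop := exists a, winning S a.

(* The pair (c, l) with c != 0 stands for the affine hyperplane
   {x : <x, c> = l}. *)
Definition on_hyperplane c l x : bool := inner x c == l.

Definition above S c l : {fset 'rV[R]_d} := [fset x in S | inner x c > l].
Definition below S c l : {fset 'rV[R]_d} := [fset x in S | inner x c < l].

Definition halving_point S x : Prop :=
  forall c l, c != 0 -> on_hyperplane c l x ->
    (#|` above S c l|%:R <= #|` S|%:R / 2 :> R) /\
    (#|` below S c l|%:R <= #|` S|%:R / 2 :> R).

Definition collinear S : Prop :=
  exists p v, v != 0 /\ forall x, x \in S -> exists t : R, x = p + t *: v.

End VoronoiGame.

(* Main.v *)
(* Putting c = b - a, Alice gets the points x of S with <x - a, c> < |c|^2/2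
   and Bob those with <x - a, c> > |c|^2/2.  As b tends to a in a fixed
   direction, Bob's set becomes {<x - a, c> > 0} and Alice's its complement,
   so a is winning exactly when it is halving.  If a and b are both halving and
   <a, c> < <b, c>, then {<x, c> > <a, c>} and {<x, c> < <b, c>} cover S and
   each has at most |S|/2 points, so no point of S lies strictly between the two
   parallel hyperplanes; but any point off the line ab is strictly between them
   for a suitable c. *)
Require Import Defs.
From mathcomp Require Import all_boot all_order all_algebra.
From mathcomp Require Import finmap reals.
From mathcomp Require Import ring lra zify.

Set Implicit Arguments.
Unset Strict Implicit.
Unset Printing Implicit Defensive.

Import Order.TTheory GRing.Theory Num.Theory.
Local Open Scope fset_scope.
Local Open Scope ring_scope.

Lemma card_fset_filter (K : choiceType) (S : {fset K}) (P : pred K) :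
  #|` [fset x in S | P x]| = count P S.
Proof.
rewrite -size_filter; apply: perm_size; apply: uniq_perm.
- exact: fset_uniq.
- exact/filter_uniq/fset_uniq.
- by move=> x; rewrite !inE /= mem_filter andbC.
Qed.

Lemma natr_le_half (R : realFieldType) (m n : nat) :
  (m%:R <= n%:R / 2 :> R) = (m.*2 <= n)%N.
Proof. by rewrite ler_pdivlMr // -natrM ler_nat muln2. Qed.

(** This replaces the limit of [b] tending to [a]: as [s] is finite, one small enough [e] serves all
    its elements. Half of each positive value enters the minimum so that the comparison stays
    strict. *)
Lemma pos_values_bounded_below (R : realFieldType) (T : eqType) (s : seq T)
    (f : T -> R) :
  exists2 e, 0 < e & {in s, forall x, (0 < f x) = (e < f x)}.
Proof.
elim: s => [|y s [e e0 IH]]; first by exists 1.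
have [fy|fy] := ltP 0 (f y); last first.
  exists e => // x; rewrite inE => /predU1P[->|/IH //].
  by rewrite !ltNge fy (le_trans fy (ltW e0)).
exists (Num.min e (f y / 2)); first by rewrite lt_min e0 divr_gt0.
move=> x; rewrite inE gt_min => /predU1P[->|xs].
  by rewrite fy; apply/esym/orP; right; lra.
rewrite -IH //; case: (ltP 0 (f x)) => //= fx.
by apply/esym/negbTE; rewrite -leNgt; lra.
Qed.

Section Inner.
Variables (R : realType) (d : nat).
Implicit Types (S : {fset 'rV[R]_d}) (a b c u v x y z : 'rV[R]_d).

Lemma innerC x y : inner x y = inner y x.
Proof. by apply: eq_bigr => i _; rewrite mulrC. Qed.

Lemma innerDl x y z : inner (x + y) z = inner x z + inner y z.
Proof. by rewrite -big_split; apply: eq_bigr => i _; rewrite mxE mulrDl. Qed.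

Lemma innerZl k x z : inner (k *: x) z = k * inner x z.
Proof. by rewrite mulr_sumr; apply: eq_bigr => i _; rewrite mxE mulrA. Qed.

Lemma innerNl x z : inner (- x) z = - inner x z.
Proof. by rewrite -scaleN1r innerZl mulN1r. Qed.

Lemma innerBl x y z : inner (x - y) z = inner x z - inner y z.
Proof. by rewrite innerDl innerNl. Qed.

Lemma innerDr x y z : inner z (x + y) = inner z x + inner z y.
Proof. by rewrite !(innerC z) innerDl. Qed.

Lemma innerZr k x z : inner z (k *: x) = k * inner z x.
Proof. by rewrite !(innerC z) innerZl. Qed.

Lemma innerNr x z : inner z (- x) = - inner z x.
Proof. by rewrite !(innerC z) innerNl. Qed.

Lemma innerBr x y z : inner z (x - y) = inner z x - inner z y.
Proof. by rewrite !(innerC z) innerBl. Qed.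

Lemma inner_ge0 x : 0 <= inner x x.
Proof. by apply: sumr_ge0 => i _; rewrite -expr2 sqr_ge0. Qed.

Lemma inner_gt0 x : x != 0 -> 0 < inner x x.
Proof.
rewrite lt_def inner_ge0 andbT; apply: contraNneq => x0.
apply/eqP/rowP => i; rewrite mxE; apply/eqP; rewrite -sqrf_eq0 expr2; apply/eqP.
by apply: (psumr_eq0P (F := fun j => x ord0 j * x ord0 j) _ x0) => // j _;
  rewrite -expr2 sqr_ge0.
Qed.

Lemma dist_lt a b x :
  (dist a x < dist b x) = (inner (x - a) (b - a) < inner (b - a) (b - a) / 2).
Proof.
rewrite /dist ltNge ler_sqrt ?inner_ge0 // -ltNge.
rewrite !(innerBl, innerBr) (innerC b a) (innerC x a) (innerC x b).
by apply/idP/idP; lra.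
Qed.

Lemma dist_gt a b x :
  (dist b x < dist a x) = (inner (b - a) (b - a) / 2 < inner (x - a) (b - a)).
Proof.
rewrite /dist ltNge ler_sqrt ?inner_ge0 // -ltNge.
rewrite !(innerBl, innerBr) (innerC b a) (innerC x a) (innerC x b).
by apply/idP/idP; lra.
Qed.

Lemma winning_count S a :
  winning S a <-> forall c,
    (count (fun x => inner c c / 2 < inner (x - a) c)%R S <=
     count (fun x => inner (x - a) c < inner c c / 2)%R S)%N.
Proof.
have scoreE b : scoreA S a b = count (fun x =>
    inner (x - a) (b - a) < inner (b - a) (b - a) / 2) S /\
  scoreB S a b = count (fun x =>
    inner (b - a) (b - a) / 2 < inner (x - a) (b - a)) S.
  split; rewrite /scoreA /scoreB card_fset_filter; apply: eq_count => x.
    exact: dist_lt.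
  exact: dist_gt.
split=> [win c|win b]; last by have [-> ->] := scoreE b; exact: win.
by have := win (a + c); have [-> ->] := scoreE (a + c); rewrite addrC addKr.
Qed.

(** Passing through [a] forces [l] to be [inner a c], and replacing [c] by [- c] swaps the two open
    half-spaces, so one side is enough. *)
Lemma halving_count S a :
  halving_point S a <->
  forall c, c != 0 -> ((count (fun x => 0 < inner (x - a) c)%R S).*2 <= #|` S|)%N.
Proof.
split=> [half c c0|half c l c0 /eqP al].
  have [+ _] := half c (inner a c) c0 (eqxx _).
  rewrite natr_le_half /above card_fset_filter.
  by under eq_count do rewrite -subr_gt0 -innerBl.
rewrite !natr_le_half /above /below !card_fset_filter -al; split.
  by under eq_count do rewrite -subr_gt0 -innerBl; exact: half.
under eq_count do rewrite -subr_gt0 -innerBl -opprB innerNl -innerNr.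
by apply: half; rewrite oppr_eq0.
Qed.

Lemma winning_halving S a : winning S a <-> halving_point S a.
Proof.
rewrite winning_count halving_count; split=> [win c c0|half c].
  have cc := inner_gt0 c0.
  have [e e0 eP] := pos_values_bounded_below S (fun x => inner (x - a) c).
  (* With this [t], the bisector of [a] and [a + t *: c] is the hyperplane where [inner (x - a) c]
     equals [e]. *)
  pose t := 2 * e / inner c c.
  have t0 : 0 < t by rewrite divr_gt0 ?mulr_gt0.
  have tcE : inner (t *: c) (t *: c) / 2 = t * e.
    by rewrite innerZl innerZr /t; field; rewrite gt_eqF.
  have := win (t *: c); rewrite tcE.
  under eq_count do rewrite innerZr ltr_pM2l //.
  under [X in (_ <= X)%N]eq_count do rewrite innerZr ltr_pM2l //.
  move=> le_count; rewrite (eq_in_count eP).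
  rewrite -(count_predC (fun x => e < inner (x - a) c) S) -addnn leq_add2l.
  by apply: leq_trans le_count _; apply: sub_count => x /=; rewrite -leNgt => /ltW.
(* Here Bob plays [a] itself; the halving condition says nothing about [c = 0], but then nobody
   scores. *)
have [->|c0] := eqVneq c 0.
  have in0 z : inner z (0 : 'rV[R]_d) = 0 by rewrite -(scale0r 0) innerZr mul0r.
  by under eq_count do rewrite !in0 mul0r ltxx; rewrite count_pred0.
have cc := inner_gt0 c0.
have := half c c0; rewrite -(count_predC (fun x => 0 < inner (x - a) c) S) -addnn.
rewrite leq_add2l => le_count.
(* The bisector lies strictly on the positive side of the hyperplane through [a]: Bob's voters are
   all on that side, and all points off that side vote for Alice. *)
apply: (@leq_trans (count (fun x => 0 < inner (x - a) c) S)).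
  by apply: sub_count => x /=; lra.
apply: leq_trans le_count _.
by apply: sub_count => x /=; rewrite -leNgt; lra.
Qed.

Lemma halving_strip_empty S a b c x : halving_point S a -> halving_point S b ->
  0 < inner (b - a) c -> x \in S ->
  ~~ (0 < inner (x - a) c < inner (b - a) c).
Proof.
move=> /halving_count ha /halving_count hb ab xS; apply/negP => strip.
have c0 : c != 0.
  by apply: contraTneq ab => ->; rewrite -(scale0r 0) innerZr mul0r ltxx.
have := ha c c0; have := hb (- c); rewrite oppr_eq0 => /(_ c0).
set P := fun x => 0 < inner (x - a) c.
set Q := fun x => 0 < inner (x - b) (- c).
(* Inclusion-exclusion: the half-spaces [P] and [Q] cover [S], so their counts add up to [#|]
   S|[plus the size of the overlap. Each is at most half of]#|[S|], hence the overlap is empty. *)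
have := count_predUI P Q S.
have -> : count (predU P Q) S = #|` S|.
  apply/eqP; rewrite -all_count; apply/allP => y _ /=.
  by rewrite /P /Q innerNr; move: ab; rewrite !innerBl; lra.
have : (0 < count (predI P Q) S)%N.
  rewrite -has_count; apply/hasP; exists x => //=.
  by rewrite /P /Q innerNr; move: strip; rewrite !innerBl; lra.
lia.
Qed.

Lemma separating_direction u v : u != 0 -> (forall t, v != t *: u) ->
  exists c, inner u c = 1 /\ inner v c = 1 / 2.
Proof.
move=> u0 v_off; have uu := inner_gt0 u0.
(* Gram-Schmidt: [w] is the part of [v] orthogonal to [u], nonzero because [v] is off the line of
   [u]. *)
pose t := inner v u / inner u u; pose w := v - t *: u.
have ww : 0 < inner w w by apply: inner_gt0; rewrite subr_eq0.
have uw : inner u w = 0.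
  by rewrite /w innerBr innerZr (innerC u v) /t; field; rewrite gt_eqF.
have vw : inner v w = inner w w.
  by rewrite [in RHS]/w innerBl innerZl uw mulr0 subr0.
clearbody w.
(* The first coefficient gives [inner u c = 1] and contributes [t] to [inner v c]; the second
   supplies the missing [1 / 2 - t]. *)
exists ((inner u u)^-1 *: u + ((1 / 2 - t) / inner w w) *: w).
rewrite !innerDr !innerZr uw vw /t; split; by field; rewrite ?gt_eqF.
Qed.

(** A point of [S] off the line through [a] and [b] would lie midway between two parallel
    hyperplanes through them, in a strip that must be empty. *)
Lemma two_halving_points_collinear S a b : a != b ->
  halving_point S a -> halving_point S b -> collinear S.
Proof.
move=> ab ha hb; have u0 : b - a != 0 by rewrite subr_eq0 eq_sym.
exists a, (b - a); split=> // x xS; apply: boolp.contrapT => off.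
have [t|c [uc vc]] := @separating_direction (b - a) (x - a) u0.
  by apply/eqP => xE; apply: off; exists t; rewrite -xE addrC subrK.
have := halving_strip_empty ha hb (c := c) _ xS; rewrite uc vc.
by move=> /(_ ltr01)/negP; apply; apply/andP; split; lra.
Qed.

End Inner.

Theorem theorem1 (R : realType) (d : nat) (hd : (1 <= d)%N)
    (S : {fset 'rV[R]_d}) :
  (alice_wins S <-> exists x : 'rV[R]_d, halving_point S x) /\
  (~ collinear S ->
   ~ exists a b : 'rV[R]_d, a <> b /\ winning S a /\ winning S b).
Proof.
split; first by split=> -[a /winning_halving ha]; exists a.
move=> ncol [a [b [/eqP ab [/winning_halving ha /winning_halving hb]]]].
exact/ncol/(two_halving_points_collinear ab ha hb).
Qed.
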